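(* Let $p$ be a prime number and let $G$ be a $d$-generated finite $p$-group of nilpotency class $c<p$. Then there exist a powerful $p$-central $p$-group $\widehat{G}$ whose number of generators is bounded by a function of $d$ and $c$ only, and a normal subgroup $N$ of $G$, such that: (a) $|N|$ is bounded by a function of $p,c,d$ only; (b) $G/N$ can be embedded as a subgroup of $\widehat{G}/\Omega_1(\widehat{G})$; (c) the index $|\widehat{G}/\Omega_1(\widehat{G}):G/N|$ is bounded by a function of $p,c,d$ only.
   Context: For a group $G$, $G^p$ is the subgroup generated by $p$-th powers and $\Omega_1(G)=\langle g\in G\mid g^p=1\rangle$. A $p$-group $G$ is powerful if $[G,G]\subseteq G^p$, and $p$-central if all its elements of order $p$ lie in its center. *)

(* Defs.v *)
From mathcomp Require Import all_boot all_fingroup all_solvable.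
Set Implicit Arguments. Unset Strict Implicit. Unset Printing Implicit Defensive.
Import GroupScope.
Local Open Scope group_scope.

Definition d_generated (gT : finGroupType) (d : nat) (G : {set gT}) : Prop :=
  exists X : {set gT}, #|X| <= d /\ <<X>> = G.

(* powerful: [G,G] \subset G^p, with G^p = 'Mho^1(G) (the subgroup generated
   by p-th powers, for a p-group G) *)
Definition powerful (gT : finGroupType) (G : {set gT}) : bool :=
  [~: G, G] \subset 'Mho^1(G).

Definition p_central (p : nat) (gT : finGroupType) (G : {set gT}) : Prop :=
  forall x, x \in G -> #[x] = p -> x \in 'Z(G).

(* Main.v *)
(* Put q = p^c. In a p-group X of class at most c the subgroup 'Mho^c(X) is
   powerful and p-central, because y^p = 1 forces [y, z^q] = 1.

   Let F be the relatively free group on x_1, ..., x_d in the variety generated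
   by G, realised as the coordinate functions on the d-tuples of G. Composing
   with t |-> t^q gives an endomorphism delta of F with delta(x_i) = x_i^q.
   Write G = F / R, and let W be the normal closure of delta(R) in F and
   X = F / W. Then delta induces a map from G to 'Mho^c(X) modulo its Ohm_1.

   Every element of F has a bounded power in delta(F), and every element of W
   has a bounded power in delta(R), since delta(F) normalises delta(R) and
   contains the q-th powers of the generators. As F has a cyclic series of
   length bounded in terms of c and d, such exponent bounds are index bounds:
   they bound the index of the image, the order of ker delta, which is
   |F : delta(F)|, and hence the order of the kernel of the map on G. *)
Require Import Defs.
From mathcomp Require Import all_boot all_fingroup all_solvable.
Set Implicit Arguments. Unset Strict Implicit. Unset Printing Implicit Defensive.
Import GroupScope.
Local Open Scope group_scope.

(** * Commutators with powers in a nilpotent group *)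

(** Induction on [i]: modulo ['L_i.+3(H)] the commutator of [y] and [z' = z^(n^i)] is central, so
    its [n]-th power equals both [[y, z'^n]] and [[y^n, z'] = 1]. *)
Lemma comm_exp_lcn (gT : finGroupType) (H : {group gT}) n i y z :
  y \in H -> z \in H -> y ^+ n = 1 -> [~ y, z ^+ (n ^ i)] \in 'L_i.+2(H).
Proof.
move=> Hy Hz yn1; elim: i => [|i IHi]; first by rewrite expn0 expg1 mem_commg.
set K := 'L_i.+3(H); set z' := z ^+ (n ^ i) in IHi.
have Hz' : z' \in H by rewrite groupX.
have nKH : H \subset 'N(K) by apply: lcn_norm.
have [Ny Nz] := (subsetP nKH _ Hy, subsetP nKH _ Hz').
have cH u : u \in H -> commute (coset K u) [~ coset K y, coset K z'].
  move=> Hu; rewrite -morphR //.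
  have sC : 'L_i.+2(H) / K \subset 'C(H / K) by rewrite quotient_cents2r // lcnSn.
  exact: commute_sym (centsP sC _ (mem_quotient K IHi) _ (mem_quotient K Hu)).
rewrite expnSr expgM -/z'.
apply: coset_idr; first by rewrite (subsetP nKH) // groupR // groupX.
rewrite (morphR _ Ny (groupX n Nz)) (morphX _ _ Nz) commgX; last exact: cH.
rewrite -commXg; last exact: cH.
by rewrite -morphX // yn1 morph1 comm1g.
Qed.

Lemma lcn_trivS (gT : finGroupType) (H : {group gT}) c :
  'L_c.+1(H) = 1 -> 'L_c.+2(H) = 1.
Proof. by move=> clH; apply/trivgP; rewrite -clH lcn_subS. Qed.

Section PowersOfNilpotentGroups.

Variables (gT : finGroupType) (p c : nat) (X : {group gT}).
Hypotheses (pX : p.-group X) (clX : 'L_c.+1(X) = 1).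

Lemma Mho_p_central : p_central p 'Mho^c(X).
Proof.
move=> y Py oy; rewrite inE Py; have Xy := subsetP (Mho_sub c X) y Py.
rewrite -sub1set centsC (MhoE c pX) gen_subG; apply/subsetP=> _ /imsetP[z Xz ->].
rewrite /= cent_set1; apply/cent1P/commute_sym/commgP/eqP/set1P.
rewrite -set1gE -(lcn_trivS clX).
by apply: comm_exp_lcn => //; rewrite -oy expg_order.
Qed.

(** Modulo [K] a generator [y^(p^c)] has trivial [p]-th power, so it commutes with every [z^(p^c)].
    Thus the derived subgroup lies in [K], which is generated by [p]-th powers of such
    generators. *)
Lemma Mho_powerful : powerful 'Mho^c(X).
Proof.
set K := 'Mho^c.+1(X).
have sKP : K \subset 'Mho^1('Mho^c(X)).
  rewrite {}/K (MhoE _ pX) gen_subG; apply/subsetP=> _ /imsetP[z Xz ->].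
  have pz := mem_p_elt pX Xz; rewrite expnSr expgM.
  have Pz : z ^+ (p ^ c) \in 'Mho^c(X) by apply: Mho_p_elt.
  by have := Mho_p_elt 1 Pz (mem_p_elt pX (groupX _ Xz)); rewrite expn1.
apply: subset_trans sKP; have nKX : X \subset 'N(K) := normal_norm (Mho_normal _ _).
have nKP : 'Mho^c(X) \subset 'N(K) := subset_trans (Mho_sub _ _) nKX.
rewrite -quotient_cents2 // quotientE morphim_Mho //= -quotientE.
have pXK : p.-group (X / K) by apply: quotient_pgroup.
rewrite (MhoE _ pXK) -[_ \subset _]/(abelian _) abelian_gen.
apply/centsP=> _ /imsetP[y Xy ->] _ /imsetP[z Xz ->].
have clXK : 'L_c.+1(X / K) = 1 by rewrite -morphim_lcn // clX morphim1.
apply/commgP/eqP/set1P; rewrite -set1gE -(lcn_trivS clXK).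
apply: comm_exp_lcn => //; rewrite ?groupX // -expgM -expnSr.
case/morphimP: Xy => x Nx Xx ->; rewrite -morphX //; apply: coset_id.
by rewrite Mho_p_elt ?(mem_p_elt pX).
Qed.

End PowersOfNilpotentGroups.

(** * Series with cyclic factors *)

(** Each term need only be normal in the one above it, and trivial factors are allowed, so [m] is
    just an upper bound for the length. *)
Fixpoint pcyc (gT : finGroupType) (m : nat) (H : {group gT}) : Prop :=
  if m is m'.+1 then
    exists K : {group gT}, [/\ K <| H, cyclic (H / K) & pcyc m' K]
  else H \subset [1].

Lemma pcycS (gT : finGroupType) m (G H : {group gT}) :
  H \subset G -> pcyc m G -> pcyc m H.
Proof.
elim: m G H => [|m IHm] G H sHG /=; first exact: subset_trans.
case=> K [nKG cGK pK]; exists (H :&: K)%G; split.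
- by rewrite (normalGI sHG).
- have nKH := subset_trans sHG (normal_norm nKG).
  rewrite /= setIC (isog_cyclic (second_isog nKH)).
  by rewrite (cyclicS (quotientS K sHG)).
- exact: IHm (subsetIr _ _) pK.
Qed.

Lemma pcyc_gen (gT : finGroupType) m (H : {group gT}) :
  pcyc m H -> d_generated m H.
Proof.
elim: m H => [|m IHm] H /=.
  move/trivgP->; exists set0; rewrite cards0; split=> //; exact: gen0.
case=> K [nKH /cyclicP[a aP] /IHm[Y [sY YK]]].
have: a \in H / K by rewrite aP cycle_id.
case/morphimP=> x Nx Hx ax; exists (x |: Y); split.
  by rewrite cardsU1; case: (_ \notin _) => //; apply: leq_trans sY _.
set M := <<x |: Y>>%G; have sKM : K \subset M by rewrite -YK genS ?subsetUr.
apply/eqP; rewrite eqEsubset -{2}[<<_>>]/(gval M).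
rewrite gen_subG subUset sub1set Hx -gen_subG YK (normal_sub nKH).
rewrite -(quotientSGK (normal_norm nKH) sKM) aP cycle_subG ax mem_quotient //.
by rewrite mem_gen ?setU11.
Qed.

(** The index splits along [K]: in the cyclic group [H / K] a generator has its [n]-th power in
    [E / K], giving a factor at most [n], and [K] is handled by induction. *)
Lemma pcyc_index (gT : finGroupType) n m (H E : {group gT}) :
  0 < n -> pcyc m H -> E \subset H -> (forall h, h \in H -> h ^+ n \in E) ->
  #|H : E| <= n ^ m.
Proof.
move=> n_gt0; elim: m H E => [|m IHm] H E /=.
  move=> H1 _ _; apply: leq_trans (dvdn_leq _ (dvdn_indexg H E)) _ => //.
  by rewrite (trivgP H1) cards1.
case=> K [nKH cHK pK] sEH HnE; have nKHn := normal_norm nKH.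
have sKH := normal_sub nKH.
rewrite -(index_quotient_ker sEH nKHn) expnS (setIidPr sKH) -[#|K : E|]indexgI.
apply: leq_mul; last first.
  apply: IHm pK (subsetIl _ _) _ => h Kh.
  by rewrite inE groupX // HnE // (subsetP sKH).
have /cyclicP[a aP] := cHK.
have nEH : H / K \subset 'N(E / K).
  by rewrite cents_norm // (subset_trans (cyclic_abelian cHK)) // centS ?quotientS.
rewrite -card_quotient // aP quotient_cycle; last first.
  by rewrite (subsetP nEH) // aP cycle_id.
rewrite -orderE dvdn_leq // order_dvdn.
have: a \in H / K by rewrite aP cycle_id.
case/morphimP=> x Nx Hx ->; have nEx := subsetP nEH _ (mem_quotient K Hx).
rewrite -(morphX _ _ nEx) -(morphX _ _ Nx); apply/eqP/coset_id.
by rewrite mem_quotient ?HnE.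
Qed.

Lemma pcyc_leq (gT : finGroupType) m n (H : {group gT}) :
  m <= n -> pcyc m H -> pcyc n H.
Proof.
move/subnK <-; elim: (n - m) => // k IHk /IHk pH; exists H.
by rewrite normal_refl trivg_quotient cyclic1.
Qed.

Lemma pcyc_quot_gen (gT : finGroupType) m (X K : {group gT}) (B : {set gT}) :
  pcyc m K -> X^`(1) \subset K -> <<B>> <*> K = X -> pcyc (#|B| + m) X.
Proof.
move=> pK; move: {2}#|B| (erefl #|B|) => n; elim: n X B => [|n IHn] X B sB sXK defX.
  have B0 : B = set0 by apply/eqP; rewrite -cards_eq0 sB.
  by move: defX; rewrite sB B0 gen0 joing1G => /val_inj <-.
have [b Bb] : exists b, b \in B by apply/set0Pn; rewrite -card_gt0 sB.
move: sB; rewrite (cardsD1 b) Bb add1n => -[sB].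
set Y := (<<B :\ b>> <*> K)%G.
have sYX : Y \subset X by rewrite -defX genS // setSU // genS // subD1set.
have nYX : Y <| X by apply: sub_der1_normal => //; rewrite (subset_trans sXK) ?joing_subr.
exists Y; split => //; last first.
  by apply: IHn => //; rewrite (subset_trans _ sXK) // dergS.
have -> : X :=: <[b]> <*> Y.
  rewrite /= joingA -defX; congr (_ <*> _).
  by rewrite joing_idl joing_idr -{1}(setD1K Bb).
rewrite quotientYidr ?quotient_cyclic ?cycle_cyclic //.
rewrite cycle_subG (subsetP (normal_norm nYX)) // -defX.
by rewrite mem_gen // inE mem_gen.
Qed.

(** [C] consists of iterated commutators of generators. In the inductive step, [X] centralises
    ['L_i.+1(X)] modulo [K] as soon as the generators [B] and [C] commute there. *)
Lemma lcn_quot_gen (gT : finGroupType) (X : {group gT}) (B : {set gT}) i :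
  <<B>> = X -> exists2 C : {set gT}, #|C| <= #|B| ^ i.+1
    & <<C>> <*> 'L_i.+2(X) = 'L_i.+1(X).
Proof.
move=> defX; elim: i => [|i [C sC defL]].
  by exists B; rewrite ?expn1 // lcn1 defX (joing_idPl _) ?lcn_sub.
exists [set [~ a, b] | a in C, b in B].
  rewrite expnSr (leq_trans _ (leq_mul sC (leqnn _))) // -cardsX curry_imset2X.
  exact: leq_imset_card.
set D := [set _ | _ in _, _ in _].
have sBX : B \subset X by rewrite -defX subset_gen.
have sCL : C \subset 'L_i.+1(X) by rewrite -defL sub_gen // subsetU // subset_gen.
have sDL : D \subset 'L_i.+2(X).
  apply/subsetP=> _ /imset2P[a b Ca Bb ->].
  by rewrite mem_commg ?(subsetP sCL) ?(subsetP sBX).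
set K := (<<D>> <*> 'L_i.+3(X))%G.
have sKL : K \subset 'L_i.+2(X) by rewrite join_subG gen_subG sDL lcn_subS.
have sL3K : 'L_i.+3(X) \subset K by rewrite joing_subr.
have nKX : X \subset 'N(K).
  by rewrite -commg_subl (subset_trans _ sL3K) // commSg.
have sDK : D \subset K by apply: subset_trans (subset_gen D) (joing_subl _ _).
have -> : <<D>> <*> 'L_i.+3(X) = K by [].
clearbody K; apply/eqP; rewrite eqEsubset sKL /=.
have sLX := lcn_sub i.+1 X.
rewrite lcnSn -quotient_cents2 ?(subset_trans sLX) // -defL quotientY; last first.
- exact: subset_trans (lcn_sub _ _) nKX.
- by rewrite gen_subG (subset_trans sCL) ?(subset_trans sLX).
rewrite join_subG; apply/andP; split; last first.
  exact: quotient_cents2r sL3K.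
have nKB := subset_trans sBX nKX; have nKC := subset_trans sCL (subset_trans sLX nKX).
have -> : X / K = <<B / K>> by rewrite -quotient_gen // defX.
rewrite quotient_gen // gen_subG /= cent_gen.
apply/centsP=> _ /morphimP[a Na Ca ->] _ /morphimP[b Nb Bb ->].
apply/commgP; rewrite -morphR //; apply/eqP/coset_id.
by rewrite (subsetP sDK) ?imset2_f.
Qed.

Lemma pcyc_lcn (gT : finGroupType) (X : {group gT}) (B : {set gT}) d c :
  <<B>> = X -> #|B| <= d -> 'L_c.+1(X) = 1 -> pcyc (\sum_(i < c) d ^ i.+1) X.
Proof.
move=> defX sB clX.
(* The series is built upwards from the trivial term ['L_c.+1(X)]; [k] counts the terms already
   passed. *)
suff pL k i : i + k = c -> pcyc (\sum_(i <= j < c) d ^ j.+1) [group of 'L_i.+1(X)].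
  by have := pL c 0 (add0n c); rewrite big_mkord; congr pcyc; apply: val_inj.
elim: k i => [|k IHk] i; first by rewrite addn0 => ->; rewrite big_geq //= clX.
rewrite -addSnnS => defc; have ltic : i < c by rewrite -defc leq_addr.
have [C sC defL] := lcn_quot_gen i defX; rewrite big_ltn //.
have sL : [group of 'L_i.+1(X)]^`(1) \subset 'L_i.+2(X) by rewrite commgS ?lcn_sub.
apply: pcyc_leq (pcyc_quot_gen (IHk _ defc) sL defL).
by rewrite leq_add2r (leq_trans sC) // leq_exp2r.
Qed.

(** * Exponents that carry a normal subgroup into a smaller subgroup *)

Lemma group_set_exp_mod (gT : finGroupType) (W T : {group gT}) n :
  W^`(1) \subset T -> T \subset W -> group_set [set m in W | m ^+ n \in T].
Proof.
move=> sW1T sTW; have nTW := normal_norm (sub_der1_normal sW1T sTW).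
have cWT : abelian (W / T) by rewrite /abelian quotient_cents2r.
apply/group_setP; split; first by rewrite inE group1 expg1n group1.
move=> a b; rewrite !inE => /andP[Wa Ta] /andP[Wb Tb]; rewrite groupM //=.
have [Na Nb] := (subsetP nTW _ Wa, subsetP nTW _ Wb).
apply: coset_idr; first by rewrite groupX ?groupM.
rewrite morphX ?groupM // morphM // expgMn; last first.
  exact: (centsP cWT _ (mem_quotient _ Wa) _ (mem_quotient _ Wb)).
by rewrite -(morphX _ _ Na) -(morphX _ _ Nb) /= !coset_id ?mul1g.
Qed.

(** The lower central series of [D] relative to [V]; for [V = D] it is the usual one, shifted by
    one. *)
Fixpoint rlcn (gT : finGroupType) (D V : {group gT}) i : {group gT} :=
  if i is i'.+1 then [~: rlcn D V i', D]%G else V.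

(* n ^ tri c = n * n^2 * ... * n^(c+1), one factor per step of the series. *)
Definition tri c := \sum_(i < c.+1) i.+1.

Section PowersIntoSubgroup.

Variables (gT : finGroupType) (D V S : {group gT}) (A : {set gT}) (n : nat).
Hypotheses (defD : <<A>> = D) (nVD : V <| D) (sSV : S \subset V).
Hypothesis nSA : forall a, a \in A -> a ^+ n \in 'N(S).
Hypothesis VnS : forall v, v \in V -> v ^+ n \in S * [~: V, D].

Notation Vi := (rlcn D V).

Lemma rlcn_normal i : Vi i <| D.
Proof.
elim: i => //= i IHi; rewrite /normal commg_normr andbT.
exact: subset_trans (commSg _ (normal_sub IHi)) (der_sub 1 D).
Qed.

Lemma rlcn_subS i : Vi i.+1 \subset Vi i.
Proof. by rewrite /= commg_subl normal_norm ?rlcn_normal. Qed.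

Lemma rlcn_sub_lcn i : Vi i \subset 'L_i.+1(D).
Proof. by elim: i => [|i IHi]; [apply: normal_sub | apply: commSg]. Qed.

Lemma rlcn_central i u y : u \in Vi i -> y \in D ->
  commute (coset (Vi i.+1) u) (coset (Vi i.+1) y).
Proof.
move=> Vu Dy.
have sC : Vi i / Vi i.+1 \subset 'C(D / Vi i.+1) by rewrite quotient_cents2r.
exact: (centsP sC _ (mem_quotient _ Vu) _ (mem_quotient _ Dy)).
Qed.

(* Commutation is bilinear from Vi i and D to Vi i.+1 modulo Vi i.+2, so
   [v, a]^(n^(i+2)) is [v^(n^(i+1)), a^n] there, and the latter is [s, a^n] for
   some s in S, which lies in S because a^n normalises S. *)
Lemma rlcn_exp i u : u \in Vi i -> u ^+ (n ^ i.+1) \in (S :&: Vi i) * Vi i.+1.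
Proof.
elim: i u => [|i IHi] u.
  by rewrite expn1 /= (setIidPl sSV); apply: VnS.
set W := Vi i.+1; set K := Vi i.+2; set N := (n ^ i.+2)%N.
have [nWD nKD] : W <| D /\ K <| D by split; apply: rlcn_normal.
have sKW : K \subset W := rlcn_subS i.+1.
have sWD := normal_sub nWD; have nKW := subset_trans sWD (normal_norm nKD).
set T := ((S :&: W) <*> K)%G.
have defT : T = (S :&: W) * K :> {set gT}.
  by rewrite /= norm_joinEl // subIset // nKW orbT.
have sKT : K \subset T by rewrite joing_subr.
have sTW : T \subset W by rewrite join_subG subsetIr.
have nTW : T <| W.
  by apply: sub_der1_normal (subset_trans (commgS W sWD) sKT) sTW.
have nTWn := normal_norm nTW.
set M := [set m in W | m ^+ N \in T].
have sW1T : W^`(1) \subset T := subset_trans (commgS W sWD) sKT.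
have gM : group_set M by apply: group_set_exp_mod.
(* Being a subgroup normalised by [D], [M] contains [W = [Vi i, D]] once it contains [[v, a]] for
   [v] in [Vi i] and [a] in the generating set [A]. *)
suff sWM : W \subset Group gM.
  by move/(subsetP sWM); rewrite inE -defT => /andP[].
have sKM : K \subset Group gM.
  by apply/subsetP=> k Kk; rewrite inE (subsetP sKW) // groupX // (subsetP sKT).
have sMW : Group gM \subset W by apply/subsetP=> m /setIdP[].
have nMD : D \subset 'N(Group gM).
  by rewrite -commg_subl (subset_trans _ sKM) // commSg.
rewrite -[gval W]/[~: Vi i, D] -quotient_cents2 //; last first.
  exact: subset_trans (normal_sub (rlcn_normal i)) nMD.
have sAD : A \subset D by rewrite -defD subset_gen.
have -> : D / Group gM = <<A / Group gM>>.
  by rewrite -quotient_gen ?defD // (subset_trans sAD).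
rewrite cent_gen; apply/centsP=> _ /morphimP[v Nv Vv ->] _ /morphimP[a Na Aa ->].
have Da := subsetP sAD a Aa.
have Dv := subsetP (normal_sub (rlcn_normal i)) v Vv.
have Wva : [~ v, a] \in W by rewrite mem_commg.
apply/commgP; rewrite -morphR //; apply/eqP/coset_id; rewrite inE Wva /=.
have nKDn := normal_norm nKD.
have cK y : y \in D -> commute (coset K y) [~ coset K v, coset K a].
  by move=> Dy; rewrite -morphR ?(subsetP nKDn) //; apply/commute_sym/rlcn_central.
have /mulsgP[s w /setIP[Ss Vs] Ww def_v] := IHi v Vv.
have Ds := subsetP (normal_sub (rlcn_normal i)) s Vs.
have Dw := subsetP sWD w Ww.
have Ts : [~ s, a ^+ n] \in T.
  rewrite mem_gen // inE inE mem_commg ?groupX // andbT commgEl groupM ?groupV //.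
  by rewrite memJ_norm // nSA.
have sTD := subset_trans sTW sWD; have sTN := subset_trans sTD nKDn.
rewrite -(quotientGK (_ : K <| T)) ?(normalS sKT sTD) //.
rewrite mem_morphpre ?(subsetP nKDn) ?groupX ?groupR //.
rewrite morphX ?(subsetP nKDn) ?groupR // morphR ?(subsetP nKDn) //.
rewrite /N expnSr -commXXg; [|exact: cK..].
rewrite -!morphX ?(subsetP nKDn) // def_v morphM ?(subsetP nKDn) //.
(* The factor [w] is central modulo [K], so only a conjugate of [[s, a^n]] by [w] survives, and [W]
   normalises [T]. *)
rewrite commMgJ.
have cw : commute (coset K w) (coset K (a ^+ n)) by apply: rlcn_central; rewrite ?groupX.
have -> : [~ coset K w, coset K (a ^+ n)] = 1 by apply/eqP/commgP.
rewrite mulg1 -morphR ?(subsetP nKDn) ?groupX //.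
rewrite -morphJ ?(subsetP nKDn) ?groupR ?groupX //.
by rewrite mem_quotient // memJ_norm // (subsetP nTWn).
Qed.

(** If the power reached so far is [s * w], then [s] and [w] commute modulo the next term, so a
    further power [n^(i+2)] acts on each separately and [rlcn_exp] pushes [w] one term down. *)
Lemma exp_tri_in_mul i v : v \in V -> v ^+ (n ^ tri i) \in S * Vi i.+1.
Proof.
move=> Vv; elim: i => [|i IHi]; first by rewrite /tri big_ord1 expn1 VnS.
rewrite /tri big_ord_recr -/(tri i) /= expnD expgM.
set K := [~: _, _]; set m := (n ^ i.+2)%N.
have /mulsgP[s w Ss Ww ->] := IHi.
have nKD := rlcn_normal i.+2; have nKDn := normal_norm nKD.
have sVD := normal_sub nVD.
have Ds := subsetP sVD s (subsetP sSV s Ss).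
have Dw := subsetP (normal_sub (rlcn_normal i.+1)) w Ww.
have /mulsgP[s' w' /setIP[Ss' _] Kw' def_w] := rlcn_exp Ww.
have Ds' := subsetP sVD s' (subsetP sSV s' Ss').
have csw := rlcn_central Ww Ds.
have nSK : S \subset 'N(Vi i.+2) := subset_trans (subset_trans sSV sVD) nKDn.
rewrite -[K]/(Vi i.+2 : {set gT}) -norm_joinEl //.
set T := (S <*> Vi i.+2)%G.
have sKT : Vi i.+2 \subset T by rewrite joing_subr.
have sTD : T \subset D by rewrite join_subG (subset_trans sSV) // normal_sub.
rewrite -[_ <*> _]/(gval T) -(quotientGK (_ : Vi i.+2 <| T)); last first.
  by rewrite (normalS sKT sTD).
rewrite mem_morphpre ?(subsetP nKDn) ?groupX ?groupM //.
rewrite morphX ?(subsetP nKDn) ?groupM // morphM ?(subsetP nKDn) //.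
rewrite expgMn; last exact: commute_sym.
rewrite -!morphX ?(subsetP nKDn) // def_w -morphM ?(subsetP nKDn) ?groupX ?groupM //.
  have sST : S \subset T by rewrite joing_subl.
  have [Ts Ts'] := (subsetP sST s Ss, subsetP sST s' Ss').
  have Tw' := subsetP sKT w' Kw'.
  by rewrite mem_quotient // groupM ?groupX // groupM.
by rewrite (subsetP (normal_sub nKD)).
Qed.

(** Applied below twice: to [F] with its subgroup [E], and to [W] with its subgroup
    [delta @* 'ker phi]. *)
Lemma exp_tri_in c v : 'L_c.+1(D) = 1 -> v \in V -> v ^+ (n ^ tri c) \in S.
Proof.
move=> clD /(exp_tri_in_mul c).
have -> : Vi c.+1 = 1%G.
  apply/val_inj/trivgP/(subset_trans (rlcn_subS c)).
  by rewrite -clD rlcn_sub_lcn.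
by rewrite mulg1.
Qed.

End PowersIntoSubgroup.

(** * The map into ['Mho^c(F / W)] modulo its ['Ohm_1], and its bounds *)

Section DilationCover.

Variables (fT gT : finGroupType) (F : {group fT}) (A : {set fT}) (p c d : nat).
Variables (delta : {morphism F >-> fT}) (phi : {morphism F >-> gT}).
Hypotheses (p_pr : prime p) (defF : <<A>> = F) (leAd : #|A| <= d).
Hypotheses (pF : p.-group F) (clF : 'L_c.+1(F) = 1).
Hypothesis deltaA : forall a, a \in A -> delta a = a ^+ (p ^ c).

(** [m] bounds the length of a cyclic series of [F]; [e] is the exponent that carries [F] into [E]
    and [W] into [S]. *)
Let m := \sum_(i < c) d ^ i.+1.
Let e := ((p ^ c) ^ tri c)%N.

Let sAF : A \subset F. Proof. by rewrite -defF subset_gen. Qed.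

Let E := (delta @* F)%G.
Let S := (delta @* 'ker phi)%G.
Let W := <<class_support S F>>%G.

Let defE : E = <<[set a ^+ (p ^ c) | a in A]>> :> {set fT}.
Proof.
rewrite /=; have -> : delta @* F = delta @* <<A>> by rewrite defF.
rewrite morphim_gen // morphimEsub //.
by congr <<_>>; apply: eq_in_imset.
Qed.

Let sE_Mho : E \subset 'Mho^c(F).
Proof.
rewrite defE gen_subG; apply/subsetP=> _ /imsetP[a Aa ->].
have Fa := subsetP sAF a Aa.
by rewrite Mho_p_elt ?(mem_p_elt pF).
Qed.

Let sEF : E \subset F := subset_trans sE_Mho (Mho_sub c F).

Let pcF : pcyc m F := pcyc_lcn defF leAd clF.

Let EAq a : a \in A -> a ^+ (p ^ c) \in E.
Proof. by move=> Aa; rewrite defE; apply/mem_gen/imsetP; exists a. Qed.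

Let Xe_in_E x : x \in F -> x ^+ e \in E.
Proof.
apply: (exp_tri_in defF (normal_refl F) sEF) => // [a Aa | v Fv].
  by rewrite (subsetP (normG E)) ?EAq.
have nF1F : F \subset 'N([~: F, F]) := der_norm 1 F.
rewrite -norm_joinEl ?(subset_trans sEF) //.
set T := (E <*> [~: F, F])%G; rewrite -[_ <*> _]/(gval T).
have sF1T : F^`(1) \subset T by rewrite joing_subr.
have sTF : T \subset F by rewrite join_subG sEF (der_sub 1 F).
(* As [F / T] is abelian, it is enough to test the power [p^c] on the generators. *)
have gM := group_set_exp_mod (p ^ c) sF1T sTF.
suff /subsetP/(_ v Fv): F \subset Group gM by rewrite inE => /andP[].
rewrite -{1}defF gen_subG; apply/subsetP=> a Aa.
by rewrite inE (subsetP sAF) // (subsetP (joing_subl _ _)) ?EAq.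
Qed.

Let indexFE : #|F : E| <= e ^ m.
Proof. by rewrite pcyc_index // !expn_gt0 prime_gt0. Qed.

Let sSE : S \subset E. Proof. by rewrite morphimS // subsetIl. Qed.
Let nWF : W <| F.
Proof.
rewrite /normal gen_subG class_support_subG ?(subset_trans sSE) //=.
by rewrite norms_gen ?class_support_norm.
Qed.
Let sSW : S \subset W.
Proof. by rewrite sub_gen // sub_class_support. Qed.

Let We_in_S w : w \in W -> w ^+ e \in S.
Proof.
have nSE : E \subset 'N(S) by rewrite normal_norm // morphim_normal // ker_normal.
apply: (exp_tri_in defF nWF sSW) => // [a Aa | v Wv].
  by rewrite (subsetP nSE) ?EAq.
have nWF_F : F \subset 'N([~: W, F]) by rewrite commg_normr.
rewrite -norm_joinEl ?(subset_trans sSE) ?(subset_trans sEF) //.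
set T := (S <*> [~: W, F])%G; rewrite -[_ <*> _]/(gval T).
(* Conjugates of elements of [S] agree with them modulo [[W, F]], so [W = S [W, F]] and no power is
   required at this stage. *)
suff sWT : W \subset T by rewrite (subsetP sWT) // groupX.
have sTW : T \subset W by rewrite join_subG sSW commg_subl normal_norm.
have nTF : F \subset 'N(T).
  by rewrite -commg_subl (subset_trans (commSg F sTW)) ?joing_subr.
by rewrite gen_subG class_support_sub_norm // joing_subl.
Qed.

Let X := (F / W)%G.
Let Gh := 'Mho^c(X)%G.
Let pX : p.-group X. Proof. exact: quotient_pgroup. Qed.
Let clX : 'L_c.+1(X) = 1.
Proof. by rewrite /= -morphim_lcn ?normal_norm // clF morphim1. Qed.

Let Om := 'Ohm_1(Gh)%G.

Let pGh : p.-group Gh. Proof. exact: pgroupS (Mho_sub _ _) pX. Qed.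

(** [p]-centrality makes the generators of [Om] central, so [Om] is abelian and its exponent divides
    [p]. *)
Let Om_exp u : u \in Om -> u ^+ p = 1.
Proof.
have sOmZ : Om \subset 'Z(Gh).
  rewrite /= Ohm1Eprime gen_subG; apply/subsetP=> x /setIdP[Gx pr_x].
  apply: (Mho_p_central pX clX Gx).
  by apply/eqP; move: (mem_p_elt pGh Gx); rewrite /p_elt pnatE // => /eqP.
have cOm : abelian Om := abelianS sOmZ (center_abelian Gh).
by rewrite [gval Om](OhmEabelian pGh cOm) expn1 => /LdivP[].
Qed.

Let sEGh : E / W \subset Gh.
Proof. by rewrite /= -morphim_Mho ?normal_norm // morphimS. Qed.

Let cover x := coset Om (coset W (delta x)).

Let delta_E x : x \in F -> delta x \in E. Proof. by move=> Fx; rewrite mem_morphim. Qed.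
Let nWE : E \subset 'N(W) := subset_trans sEF (normal_norm nWF).
Let nOm : Gh \subset 'N(Om) := normal_norm (Ohm_normal 1 Gh).

Let coverM : {in F &, {morph cover : x y / x * y}}.
Proof.
move=> x y Fx Fy; rewrite /cover morphM // morphM ?(subsetP nWE) ?delta_E //.
by rewrite morphM // (subsetP nOm) // (subsetP sEGh) // mem_quotient ?delta_E.
Qed.

Let cover_morphism := Morphism coverM.

Let im_cover : cover_morphism @* F = E / W / Om.
Proof.
rewrite morphimEdom.
apply/setP=> z; apply/imsetP/idP=> [[x Fx ->] | ].
  by rewrite !mem_quotient ?delta_E.
case/morphimP=> _ _ /morphimP[_ _ /morphimP[x _ Fx ->] ->] ->.
by exists x.
Qed.

Let ker_phi_cover : 'ker phi \subset 'ker cover_morphism.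
Proof.
apply/subsetP=> r Kr; have Fr := subsetP (subsetIl _ _) r Kr.
apply/kerP => //=; rewrite /cover [coset W _]coset_id ?morph1 //.
by rewrite (subsetP sSW) // mem_morphim.
Qed.

(** The index splits along [delta]. For [x] in the kernel, [delta x] lies in [Om] modulo [W], so its
    [p]-th power is in [W] and its [(e * p)]-th in [S]. The rest is at most the order of
    ['ker delta], which is [|F : E|]. *)
Let index_ker_cover : #|'ker cover_morphism : 'ker phi| <= (e * p) ^ m * e ^ m.
Proof.
have sKF : 'ker cover_morphism \subset F := subsetIl _ _.
rewrite -(index_morphim_ker delta ker_phi_cover sKF) leq_mul //.
  rewrite pcyc_index ?muln_gt0 ?expn_gt0 ?prime_gt0 ?morphimS //.
    by apply: pcycS pcF; rewrite (subset_trans _ sEF) ?morphimS.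
  move=> _ /morphimP[x Fx Kx ->]; rewrite mulnC expgM We_in_S //.
  have Ex := delta_E Fx; have Nx := subsetP nWE _ Ex.
  apply: coset_idr; first by rewrite groupX.
  rewrite morphX //; apply: Om_exp; apply: coset_idr.
    by rewrite (subsetP nOm) // (subsetP sEGh) // mem_quotient.
  exact: (mker Kx).
apply: leq_trans indexFE.
have cardE : (#|'ker delta| * #|E|)%N = #|F|.
  by rewrite card_morphim setIid Lagrange // subsetIl.
rewrite -(leq_pmul2l (cardG_gt0 E)) Lagrange // -cardE mulnC leq_mul2r.
rewrite (leq_trans (dvdn_leq _ (dvdn_indexg _ _))) ?orbT // subset_leq_card //.
by rewrite subsetIr.
Qed.

Lemma dilation_cover :
  exists (hT : finGroupType) (H : {group hT}) (N : {group gT}),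
    [/\ p.-group H, powerful H, p_central p H & d_generated m H] /\
    [/\ N <| phi @* F, #|N| <= (e * p) ^ m * e ^ m &
      exists f : {morphism phi @* F / N >-> coset_of 'Ohm_1(H)},
        [/\ 'injm f, f @* (phi @* F / N) \subset H / 'Ohm_1(H) &
            #|H / 'Ohm_1(H) : f @* (phi @* F / N)| <= e ^ m]].
Proof.
(* The cover factors through [phi]; its kernel there is the image of ['ker cover_morphism], which
   gives [N]. *)
pose psi := [morphism of factm ker_phi_cover (subxx F)].
exists (coset_of W), Gh, ('ker psi)%G; split; first split => //.
- exact: Mho_powerful pX clX.
- exact: Mho_p_central.
- apply: pcyc_gen; apply: pcycS (Mho_sub _ _) _.
  have defX : <<A / W>> = X.
    by rewrite -quotient_gen ?defF // (subset_trans sAF) ?normal_norm.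
  by apply: pcyc_lcn defX _ clX; rewrite (leq_trans (leq_morphim _ _)).
have [f injf imf] := first_isom psi.
have im_psi : psi @* (phi @* F) = E / W / Om by rewrite morphim_factm im_cover.
split; first exact: ker_normal.
  by rewrite /= ker_factm card_morphim (setIidPr _) ?subsetIl.
exists f; rewrite imf im_psi; split=> //; first exact: quotientS.
(* Passing to quotients and to the subgroup [Gh] of [X] only lowers the index, so everything is
   bounded by [|F : E|]. *)
apply: leq_trans indexFE.
apply: leq_trans (dvdn_leq _ (index_quotient _)) _ => //.
  by rewrite (subset_trans _ nOm) ?subsetIl.
apply: leq_trans (dvdn_leq _ (indexSg sEGh (Mho_sub _ _))) _ => //.
apply: dvdn_leq (index_quotient _) => //.
by rewrite (subset_trans _ (normal_norm nWF)) ?subsetIl.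
Qed.

End DilationCover.

(** * The relatively free group and its dilation *)

Section CoordinateFunctions.

Variables (gT : finGroupType) (G : {group gT}) (X : {set gT}) (q : nat).

(* Tuples are indexed by all of gT; only the coordinates in X are used. *)
Let T := {ffun gT -> subg_of G}.
Let fT : finGroupType := {dffun forall _ : T, gT}.

Definition coord (x : gT) : fT := [ffun t : T => sgval (t x)].

Definition coord_gens : {set fT} := [set coord x | x in X].

Definition relfree := <<coord_gens>>%G.

(** Products in [fT] are pointwise, so precomposition is multiplicative even though taking [q]-th
    powers in [G] need not be. *)
Definition dilate (f : fT) : fT := [ffun t : T => f [ffun x => t x ^+ q]].

Lemma dilateM : {in relfree &, {morph dilate : f g / f * g}}.
Proof. by move=> f g _ _; apply/ffunP=> t; rewrite !ffunE. Qed.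
Canonical dilate_morphism := Morphism dilateM.

Definition evalf (t : T) (f : fT) : gT := f t.

Lemma evalfM t : {in relfree &, {morph evalf t : f g / f * g}}.
Proof. by move=> f g _ _; rewrite /evalf ffunE. Qed.
Canonical evalf_morphism t := Morphism (@evalfM t).

Lemma expg_ffun (f : fT) n t : (f ^+ n) t = f t ^+ n.
Proof. by elim: n => [|n IHn]; rewrite ?expg0 ?expgS ffunE ?IHn. Qed.

Lemma dilate_coord x : dilate (coord x) = coord x ^+ q.
Proof.
apply/ffunP=> t; rewrite expg_ffun !ffunE.
by elim: q => [|n IHn]; rewrite ?expg0 // !expgS -IHn.
Qed.

Lemma evalf_relfree t : evalf t @* relfree \subset G.
Proof.
rewrite morphim_gen ?subset_gen // gen_subG.
apply/subsetP=> _ /morphimP[_ _ /imsetP[x _ ->] ->].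
by rewrite /= /evalf ffunE subgP.
Qed.

(** Evaluations are morphisms into [G] that jointly separate elements, so a law of [G] holds in
    [relfree]. *)
Lemma relfree_lcn c : 'L_c.+1(G) = 1 -> 'L_c.+1(relfree) = 1.
Proof.
move=> clG; apply/trivgP/subsetP=> f Lf; apply/set1P/ffunP=> t.
have Ff := subsetP (lcn_sub _ _) f Lf.
rewrite ffunE; suff: f t \in 'L_c.+1(G) by rewrite clG => /set1P.
apply: (subsetP (lcnS _ (evalf_relfree t))).
rewrite -(morphim_lcn (evalf_morphism t)) //.
exact: (mem_morphim (evalf_morphism t)).
Qed.

Lemma relfree_pgroup p : p.-group G -> p.-group relfree.
Proof.
move=> pG; rewrite -pnat_exponent.
apply: pnat_dvd pG; apply/exponentP=> f Ff; apply/ffunP=> t.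
rewrite expg_ffun ffunE; apply/eqP; rewrite -order_dvdn order_dvdG //.
by apply: (subsetP (evalf_relfree t)); apply: (mem_morphim (evalf_morphism t)).
Qed.

(** This provides the presentation of [G]. Outside [G] the value of [subg G] defaults to the
    identity, which is harmless since [X] lies in [G]. *)
Lemma evalf_id : X \subset G -> evalf [ffun x => subg G x] @* relfree = <<X>>.
Proof.
move=> sXG; rewrite morphim_gen ?subset_gen //; congr <<_>>.
have ev x : x \in X -> evalf [ffun x => subg G x] (coord x) = x.
  by move=> Xx; rewrite /evalf !ffunE subgK // (subsetP sXG).
apply/setP=> y; apply/morphimP/idP=> [[_ _ /imsetP[x Xx ->] ->]|Xy].
  by rewrite /= ev.
exists (coord y); rewrite ?imset_f ?mem_gen ?imset_f //=.
by rewrite ev.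
Qed.

End CoordinateFunctions.

Theorem theorem3p7 :
  exists (fgen : nat -> nat -> nat) (fN : nat -> nat -> nat -> nat)
         (fidx : nat -> nat -> nat -> nat),
  forall (p d c : nat) (gT : finGroupType) (G : {group gT}),
    prime p -> p.-group G -> d_generated d G ->
    nil_class G = c -> c < p ->
    exists (hT : finGroupType) (Gh : {group hT}) (N : {group gT}),
      [/\ p.-group Gh, powerful Gh, p_central p Gh &
          d_generated (fgen d c) Gh] /\
      [/\ N <| G,
          #|N| <= fN p c d &
          exists f : {morphism G / N >-> coset_of 'Ohm_1(Gh)},
            [/\ 'injm f,
                f @* (G / N) \subset Gh / 'Ohm_1(Gh) &
                #|Gh / 'Ohm_1(Gh) : f @* (G / N)| <= fidx p c d]].
Proof.
exists (fun d c => \sum_(i < c) d ^ i.+1).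
exists (fun p c d => let m := \sum_(i < c) d ^ i.+1 in let e := (p ^ c) ^ tri c in
  (e * p) ^ m * e ^ m)%N.
exists (fun p c d => ((p ^ c) ^ tri c) ^ (\sum_(i < c) d ^ i.+1))%N.
move=> p d c gT G p_pr pG [X [leXd defG]] clG _.
have clG1 : 'L_c.+1(G) = 1.
  by apply/lcn_nil_classP; rewrite ?(pgroup_nil pG) ?clG.
have sXG : X \subset G by rewrite -defG subset_gen.
pose phi := evalf_morphism X [ffun x => subg G x].
have im_phi : phi @* relfree G X = G by rewrite -[RHS]defG; apply: evalf_id.
(* Rewriting [G] as this image puts the goal in the form given by [dilation_cover]. *)
have defG' : G = (phi @* relfree G X)%G by apply/val_inj.
rewrite defG'.
pose delta := dilate_morphism G X (p ^ c).
apply: (@dilation_cover _ _ _ (coord_gens G X) p c d delta phi) => //.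
- exact: leq_trans (leq_imset_card _ _) leXd.
- exact: relfree_pgroup.
- exact: relfree_lcn.
- by move=> _ /imsetP[x _ ->]; apply: dilate_coord.
Qed.
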